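(* Let $q$ be a prime power, let $2 \le m < k$ be integers and let $L$ be an $(m \times k)$-system over $\mathbb{F}_q$ such that $s(L)$ is even. If every equation of length $s(L)$ induced by $L$ is uncommon, then $L$ is uncommon.
   Context: A system $L$ of $m$ linear forms in $k$ variables with coefficients in $\mathbb{F}_q$ is identified with its $m\times k$ coefficient matrix; it is an $(m\times k)$-system if the rows are linearly independent over $\mathbb{F}_q$. For $A\subseteq \mathbb{F}_q^n$, $\mathrm{sol}(L;A)=\{\mathbf{x}=(x_1,\dots,x_k)\in A^k : L\mathbf{x}^T=0\}$. For an $\ell$-variable system $L'$, $L$ induces $L'$ if there is a subset $\{i_1,\dots,i_\ell\}\subseteq[k]$ such that for every $\mathbf{x}\in\mathbb{F}_q^k$, $L(x_1,\dots,x_k)=0$ implies $L'(x_{i_1},\dots,x_{i_\ell})=0$. The length of an equation is the number of its variables with nonzero coefficient; an induced equation of length $s$ is regarded as a single-equation system in the $s$ variables with nonzero coefficients. $s(L)$ is the minimal length of a (nontrivial) equation induced by $L$. For $f:\mathbb{F}_q^n\to\mathbb{R}$ and a $k'$-variable system $L'$, $\Lambda_{L'}(f)=\frac{1}{|\mathrm{sol}(L';\mathbb{F}_q^n)|}\sum_{\mathbf{x}\in\mathrm{sol}(L';\mathbb{F}_q^n)}\prod_{i=1}^{k'} f(x_i)$ and $\Delta_{L'}(f)=\Lambda_{L'}(1/2+f)+\Lambda_{L'}(1/2-f)$. A $k'$-variable system $L'$ is common if for every $n\ge1$ and every $f:\mathbb{F}_q^n\to[-1/2,1/2]$ we have $\Delta_{L'}(f)\ge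 2^{1-k'}$; otherwise uncommon. *)

(* Defs.v *)
From mathcomp Require Import all_boot all_order all_algebra reals.
Set Implicit Arguments.
Unset Strict Implicit.
Unset Printing Implicit Defensive.
Import Order.TTheory GRing.Theory Num.Theory.
Local Open Scope ring_scope.

(* A tuple (x_1, ..., x_k) of vectors of F^n is the k x n matrix with rows x_i,
   so that L (x_1, ..., x_k)^T is the matrix product L *m x. *)
Definition sol (F : finFieldType) (m k n : nat) (L : 'M[F]_(m, k))
    (A : {set 'rV[F]_n}) : {set 'M[F]_(k, n)} :=
  [set x | [forall i, row i x \in A] && (L *m x == 0)].

(* The distinct indices i_1, ..., i_l are given by an injection s; rowsub s x
   is the column vector (x_{i_1}, ..., x_{i_l}). *)
Definition induces (F : finFieldType) (m k m' l : nat)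
    (L : 'M[F]_(m, k)) (L' : 'M[F]_(m', l)) : bool :=
  [exists s : {ffun 'I_l -> 'I_k}, injectiveb s &&
    [forall x : 'cV[F]_k, (L *m x == 0) ==> (L' *m rowsub s x == 0)]].

Definition eq_length (F : finFieldType) (l : nat) (E : 'rV[F]_l) : nat :=
  #|[set j | E 0 j != 0]|.

(* An induced equation has l <= k variables, hence length at most k, so neither
   the range of l nor the default value k affects the minimum as soon as L has
   rank at least 1: see min_lengthP. *)
Definition min_length (F : finFieldType) (m k : nat) (L : 'M[F]_(m, k)) : nat :=
  \big[minn/k]_(l < k.+1)
    \big[minn/k]_(E : 'rV[F]_l | (E != 0) && induces L E) eq_length E.

Definition Lambda (R : realType) (F : finFieldType) (m k n : nat)
    (L : 'M[F]_(m, k)) (f : 'rV[F]_n -> R) : R :=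
  (\sum_(x in sol L [set: 'rV[F]_n]) \prod_(i < k) f (row i x))
    / #|sol L [set: 'rV[F]_n]|%:R.

Definition Delta (R : realType) (F : finFieldType) (m k n : nat)
    (L : 'M[F]_(m, k)) (f : 'rV[F]_n -> R) : R :=
  Lambda L (fun v => 1 / 2 + f v) + Lambda L (fun v => 1 / 2 - f v).

Definition common (R : realType) (F : finFieldType) (m k : nat)
    (L : 'M[F]_(m, k)) : Prop :=
  forall (n : nat) (f : 'rV[F]_n -> R), (1 <= n)%N ->
    (forall v, - (1 / 2) <= f v <= 1 / 2) ->
    Delta L f >= 2 ^ (1 - k%:Z).

Definition uncommon (R : realType) (F : finFieldType) (m k : nat)
    (L : 'M[F]_(m, k)) : Prop := ~ common R L.

Lemma induces_le (F : finFieldType) (m k m' l : nat)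
    (L : 'M[F]_(m, k)) (L' : 'M[F]_(m', l)) : induces L L' -> (l <= k)%N.
Proof.
by case/existsP=> s /andP[/injectiveP/leq_card]; rewrite !card_ord.
Qed.

Lemma bigminn_le (I : finType) (P : pred I) (k : nat) (f : I -> nat) (i : I) :
  P i -> (\big[minn/k]_(j | P j) f j <= f i)%N.
Proof.
move=> Pi; have := mem_index_enum i.
elim: (index_enum I) => // j r IHr; rewrite inE big_cons => /orP[/eqP <-|ir].
  by rewrite Pi geq_min leqnn.
by case: ifP => _; rewrite ?geq_min IHr ?orbT.
Qed.

Lemma min_lengthP (F : finFieldType) (m k : nat) (L : 'M[F]_(m, k)) :
  (0 < m)%N -> row_free L ->
  (exists l (E : 'rV[F]_l),
     [/\ E != 0, induces L E & eq_length E = min_length L]) /\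
  (forall l (E : 'rV[F]_l),
     E != 0 -> induces L E -> (min_length L <= eq_length E)%N).
Proof.
move=> m_gt0 Lfree.
have lb l (E : 'rV[F]_l) :
    E != 0 -> induces L E -> (min_length L <= eq_length E)%N.
  move=> E0 iE; have lk : (l < k.+1)%N by rewrite ltnS (induces_le iE).
  apply: (leq_trans (bigminn_le k _ (isT : xpredT (Ordinal lk)))).
  by apply: bigminn_le; rewrite E0 iE.
split=> //.
have [E0 iE] : row (Ordinal m_gt0) L != 0 /\ induces L (row (Ordinal m_gt0) L).
  split.
    apply/negP=> /eqP r0.
    have /row_freeP[B LB] := Lfree.
    have := congr1 (fun M : 'M_m => row (Ordinal m_gt0) M) LB.
    rewrite row_mul r0 mul0mx => /rowP/(_ (Ordinal m_gt0)).
    by rewrite !mxE eqxx => /esym/eqP; rewrite oner_eq0.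
  apply/existsP; exists [ffun i => i]; apply/andP; split.
    by apply/injectiveP=> i j; rewrite !ffunE.
  apply/forallP=> x; apply/implyP=> /eqP Lx.
  have -> : rowsub [ffun i => i] x = x by apply/matrixP=> i j; rewrite !mxE ffunE.
  by rewrite -row_mul Lx row0.
pose P d := d = k \/ exists l (E : 'rV[F]_l),
  [/\ E != 0, induces L E & eq_length E = d].
have Pmin a b : P a -> P b -> P (minn a b).
  by move=> Pa Pb; rewrite /minn; case: ifP.
have : P (min_length L).
  apply: (big_ind P) => [|//|l _]; first by left.
  apply: (big_ind P) => [|//|E /andP[E1 iE1]]; first by left.
  by right; exists l, E.
case=> // mk; exists k, (row (Ordinal m_gt0) L); split=> //.
apply/eqP; rewrite eqn_leq lb // andbT mk.
by rewrite /eq_length (leq_trans (max_card _)) ?card_ord.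
Qed.

(* Main.v *)
(** Write a function on F^n as a Fourier series with coefficients c.  Averaging
    over the solutions of L x = 0 turns Lambda_L into the sum of
    prod_i c(r_i) over the row space of L (over tuples of frequencies whose
    columns lie in it, when n > 1).

    If the coefficients of an equation E of even length pair up as b, -b, every
    term of this sum is nonnegative and the zero term is the s-th power of the
    mean; hence E is common, by convexity.  So the coefficients of the shortest
    induced equations do not pair up.

    Suppose L is common, and test it on n = 1 with c(0) = 1/2 and
    c(b) = (d/2) w^(eta b), w a root of unity and eta odd.  As d tends to 0, the
    terms of weight s = s(L) dominate, so G(eta), the sum over row-space vectors
    r of weight s of Re w^(sum_i eta(r_i)), is nonnegative.  As no such r has
    coefficients pairing up, G averages to 0 over the odd eta, and so vanishes
    identically; but G(0) > 0. *)
Require Import Defs.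
From mathcomp Require Import all_boot all_order all_algebra all_field reals.
From mathcomp Require Import complex ring lra.
Set Implicit Arguments.
Unset Strict Implicit.
Unset Printing Implicit Defensive.
Import Order.TTheory GRing.Theory Num.Theory.
Local Open Scope ring_scope.

(** * Additive characters of cyclic groups and finite fields *)

Definition add_char (C : numClosedFieldType) (G : zmodType) (chi : G -> C) :=
  [/\ chi 0 = 1, forall x y, chi (x + y) = chi x * chi y
    & forall x, (chi x)^* = chi (- x)].

Lemma add_char_norm (C : numClosedFieldType) (G : zmodType) (chi : G -> C) x :
  add_char chi -> `|chi x| = 1.
Proof.
case=> chi0 chiD chiC; apply/eqP; rewrite -(@eqrXn2 _ 2) ?normr_ge0 ?ler01 //.
by rewrite normCK chiC -chiD subrr chi0 expr1n.
Qed.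

Lemma add_char_sum (C : numClosedFieldType) (G : zmodType) (chi : G -> C)
    (I : finType) (g : I -> G) :
  add_char chi -> chi (\sum_i g i) = \prod_i chi (g i).
Proof. by case=> chi0 chiD _; apply: big_morph. Qed.

(** In characteristic 0, X^n - 1 is separable, so it has n distinct roots; n distinct n-th roots of
    unity include a primitive one. *)
Lemma closed_prim_root_exists (C : numClosedFieldType) n :
  (0 < n)%N -> exists z : C, n.-primitive_root z.
Proof.
move=> n_gt0; pose p : {poly C} := 'X^n - 1.
have [r Dp] := closed_field_poly_normal p.
move: Dp; rewrite lead_coefXnsubC // scale1r => Dp.
have rn1 : all n.-unity_root r.
  by apply/allP=> z; rewrite -root_prod_XsubC -Dp.
have sz_r : (n < (size r).+1)%N.
  by rewrite -(size_prod_XsubC r id) -Dp size_XnsubC.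
have [|z] := hasP (cyclic.has_prim_root n_gt0 rn1 _ sz_r); last by exists z.
rewrite -separable_prod_XsubC -Dp separable_Xn_sub_1 //.
by rewrite pnatr_eq0 -lt0n.
Qed.

Lemma Zp_add_char (C : numClosedFieldType) N : (1 < N)%N ->
  exists2 chi : 'Z_N -> C, add_char chi & forall x, (chi x == 1) = (x == 0).
Proof.
move=> N1; have [z zP] := @closed_prim_root_exists C N (ltnW N1).
have zN := prim_expr_order zP.
pose chi (x : 'Z_N) := z ^+ x.
have chiD x y : chi (x + y) = chi x * chi y.
  have zmod j : z ^+ (j %% (Zp_trunc N).+2) = z ^+ j.
    by rewrite Zp_cast // (prim_expr_mod zP).
  by rewrite /chi -exprD /= zmod.
exists chi; last first.
  move=> x; rewrite -(expr0 z) (eq_prim_root_expr zP) mod0n.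
  have xN : (x < N)%N by rewrite -[X in (_ < X)%N](Zp_cast N1).
  by rewrite modn_small.
split=> // x.
have nz : chi x * (chi x)^* = 1.
  rewrite -normCK; suff -> : `|chi x| = 1 by rewrite expr1n.
  have n1 : `|z| = 1.
    apply/eqP; rewrite -(@eqrXn2 _ N) ?normr_ge0 ?ler01 ?(ltnW N1) //.
    by rewrite -normrX zN normr1 expr1n.
  by rewrite normrX n1 expr1n.
have nx : chi x * chi (- x) = 1 by rewrite -chiD subrr.
apply: (@mulfI _ (chi x)); last by rewrite nz nx.
by apply/eqP=> c0; move: nx; rewrite c0 mul0r => /esym/eqP; rewrite oner_eq0.
Qed.

(** A faithful character of the prime field is composed with an ['F_p]-linear coordinate of [F] that
    does not vanish at 1. *)
Lemma finField_add_char (C : numClosedFieldType) (F : finFieldType) :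
  exists2 psi : F -> C, add_char psi & exists x, psi x != 1.
Proof.
have [p p_pr pF] := finPcharP F.
pose V : vectType 'F_p := pPrimeCharType pF.
pose phi j (x : F) : 'F_p := coord (vbasis {:V}) j (x : V).
have phi0 j : phi j 0 = 0 by exact: (linear0 (coord (vbasis {:V}) j)).
have phiD j x y : phi j (x + y) = phi j x + phi j y.
  exact: (linearD (coord (vbasis {:V}) j)).
have phiN j x : phi j (- x) = - phi j x.
  exact: (linearN (coord (vbasis {:V}) j)).
have [j j0] : exists j, phi j 1 != 0.
  apply/existsP; apply: contraT; rewrite negb_exists => /forallP phi1.
  have := coord_vbasis (memvf ((1 : F) : V)).
  rewrite big1 => [/eqP|j _]; first by rewrite (negbTE (oner_neq0 F)).
  by have /negPn/eqP := phi1 j; rewrite /phi => ->; rewrite scale0r.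
(* ['F_p] unfolds to ['Z_(pdiv p)], hence the modulus [pdiv p]. *)
have pd1 : (1 < pdiv p)%N by rewrite pdiv_id ?prime_gt1.
have [chi [chi0 chiD chiC] chi1] := Zp_add_char C pd1.
exists (fun x => chi (phi j x)); last by exists 1; rewrite chi1.
by split=> [|x y|x]; rewrite ?phi0 ?phiD ?phiN ?chiD ?chiC.
Qed.

(** * Fourier analysis on solution spaces *)

Definition dotp (F : finFieldType) n (u v : 'rV[F]_n) : F := (u *m v^T) 0 0.

Lemma sum_dotp (F : finFieldType) k n (r x : 'M[F]_(k, n)) :
  \sum_i dotp (row i r) (row i x) = \tr (r *m x^T).
Proof.
apply: eq_bigr => i _; rewrite /dotp !mxE; apply: eq_bigr => j _.
by rewrite !mxE.
Qed.

Lemma mem_solT (F : finFieldType) m k n (L : 'M[F]_(m, k)) (x : 'M_(k, n)) :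
  (x \in sol L [set: 'rV_n]) = (L *m x == 0).
Proof. by rewrite inE andb_idl // => _; apply/forallP=> i; rewrite inE. Qed.

Lemma card_sol_gt0 (F : finFieldType) m k n (L : 'M[F]_(m, k)) :
  (0 < #|sol L [set: 'rV_n]|)%N.
Proof. by apply/card_gt0P; exists 0; rewrite mem_solT mulmx0. Qed.

(* The annihilator of the solution space of [L] is the row space of [L]. *)
Lemma sol_orthogonality (C : numClosedFieldType) (F : finFieldType)
    (psi : F -> C) m k n (L : 'M[F]_(m, k)) (r : 'M[F]_(k, n)) :
    add_char psi -> (exists x, psi x != 1) ->
  \sum_(x in sol L [set: 'rV_n]) psi (\tr (r *m x^T))
    = if (r^T <= L)%MS then #|sol L [set: 'rV_n]|%:R else 0.
Proof.
case=> psi0 psiD _ [z z1]; have [/submxP[D rD] | ] := ifPn.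
  rewrite -sum1_card natr_sum; apply: eq_bigr => x; rewrite mem_solT => /eqP Lx.
  rewrite -(trmxK r) rD trmx_mul -mulmxA mxtrace_mulC -mulmxA -trmx_mul Lx.
  by rewrite trmx0 mulmx0 mxtrace0 psi0.
rewrite submxE => /matrix0Pn[i [j rij]].
(* A column of the cokernel of [L], rescaled so that its pairing with [r] is [z], is a solution
   [x0]. Translating the sum by [x0] multiplies it by [psi z], which is not 1. *)
pose y := (r^T *m cokermx L) i j.
pose x0 := (z / y) *: (cokermx L *m delta_mx j i).
have Lx0 : L *m x0 = 0 by rewrite -scalemxAr mulmxA mulmx_coker mul0mx scaler0.
have rx0 : \tr (r *m x0^T) = z.
  rewrite -mxtrace_tr trmx_mul trmxK -scalemxAl mxtraceZ -mulmxA mxtrace_mulC.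
  rewrite -mulmxA /mxtrace (bigD1 j) //= big1 => [|l lj].
    rewrite addr0 mxE (bigD1 i) //= big1 => [|l li].
      by rewrite addr0 mxE !eqxx mul1r -/y divfK.
    by rewrite mxE (negbTE li) andbF mul0r.
  by rewrite mxE big1 // => i' _; rewrite mxE (negbTE lj) mul0r.
set S := \sum_(x in _) _.
have : S = psi z * S.
  rewrite {1}/S (reindex_inj (addrI x0)) /= mulr_sumr.
  apply: eq_big => [x|x _]; first by rewrite !mem_solT mulmxDr Lx0 add0r.
  by rewrite linearD /= mulmxDr raddfD /= rx0 psiD.
move/eqP; rewrite -subr_eq0 -{1}(mul1r S) -mulrBl mulf_eq0 subr_eq0 eq_sym.
by rewrite (negbTE z1) => /eqP.
Qed.

Lemma Lambda_fourier (C : numClosedFieldType) (R : realType)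
    (iota : {rmorphism R -> C}) (F : finFieldType) (psi : F -> C) m k n
    (L : 'M[F]_(m, k)) (h : 'rV[F]_n -> R) (c : 'rV[F]_n -> C) :
    add_char psi -> (exists x, psi x != 1) ->
    (forall v, iota (h v) = \sum_u c u * psi (dotp u v)) ->
  iota (Lambda L h) =
    \sum_(r : 'M[F]_(k, n) | (r^T <= L)%MS) \prod_i c (row i r).
Proof.
move=> psiA psi1 hc; have N0 : #|sol L [set: 'rV[F]_n]|%:R != 0 :> C.
  by rewrite pnatr_eq0 -lt0n card_sol_gt0.
apply: (mulIf N0); rewrite /Lambda rmorphM fmorphV rmorph_nat divfK //.
rewrite rmorph_sum mulr_suml /=.
have expand x : iota (\prod_i h (row i x)) =
    \sum_(r : 'M[F]_(k, n)) (\prod_i c (row i r)) * psi (\tr (r *m x^T)).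
  rewrite rmorph_prod (eq_bigr _ (fun i _ => hc (row i x))) bigA_distr_bigA /=.
  rewrite (reindex (fun r : 'M[F]_(k, n) => [ffun i => row i r])) /=; last first.
    exists (fun g : {ffun 'I_k -> 'rV[F]_n} => \matrix_i g i) => [r _ | g _].
      by apply/row_matrixP=> i; rewrite rowK ffunE.
    by apply/ffunP=> i; rewrite ffunE rowK.
  apply: eq_bigr => r _; rewrite -sum_dotp (add_char_sum _ psiA) -big_split /=.
  by apply: eq_bigr => i _; rewrite ffunE.
rewrite (eq_bigr _ (fun x _ => expand x)) exchange_big /= [RHS]big_mkcond /=.
apply: eq_bigr => r _.
by rewrite -mulr_sumr sol_orthogonality //; case: ifP; rewrite ?mulr0.
Qed.

(* The whole space is the solution space of the zero form in one variable. *)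
Lemma sum_dotp_char (C : numClosedFieldType) (F : finFieldType)
    (psi : F -> C) n (v : 'rV[F]_n) :
    add_char psi -> (exists x, psi x != 1) ->
  \sum_u psi (dotp u v) = if v == 0 then #|{: 'rV[F]_n}|%:R else 0.
Proof.
move=> psiA psi1.
have := sol_orthogonality (0 : 'M[F]_1) v psiA psi1.
have solT : sol (0 : 'M[F]_1) [set: 'rV[F]_n] = [set: 'rV[F]_n].
  by apply/setP=> x; rewrite mem_solT mul0mx eqxx inE.
rewrite solT submx0 trmx_eq0 cardsT => <-.
apply: eq_big => [u|u _]; first by rewrite inE.
by rewrite trace_mx11 /dotp -[in RHS](trmxK v) -trmx_mul [in RHS]mxE.
Qed.

Lemma fourier_inversion (C : numClosedFieldType) (F : finFieldType)
    (psi : F -> C) n (h : 'rV[F]_n -> C) :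
    add_char psi -> (exists x, psi x != 1) ->
  forall v, h v = \sum_u
    ((\sum_w h w * psi (- dotp u w)) / #|{: 'rV[F]_n}|%:R) * psi (dotp u v).
Proof.
move=> psiA psi1 v; have [psi0 psiD _] := psiA.
have N0 : #|{: 'rV[F]_n}|%:R != 0 :> C.
  by rewrite pnatr_eq0 -lt0n; apply/card_gt0P; exists 0.
apply: (mulIf N0); rewrite mulr_suml.
under eq_bigr => u _.
  rewrite mulrAC divfK // mulr_suml.
  under eq_bigr => w _ do rewrite -mulrA -psiD addrC.
  over.
rewrite exchange_big /= (bigD1 v) //= [X in _ + X]big1 => [|w wv].
  under eq_bigr => u _ do rewrite subrr psi0 mulr1.
  by rewrite addr0 sumr_const mulr_natr.
rewrite -mulr_sumr.
under eq_bigr => u _.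
  rewrite /dotp.
  have -> : (u *m v^T) 0 0 - (u *m w^T) 0 0 = dotp u (v - w).
    by rewrite /dotp linearB /= mulmxBr !mxE.
  over.
by rewrite sum_dotp_char // subr_eq0 eq_sym (negbTE wv) mulr0.
Qed.

(** * Cancelling equations of even length are common *)

Definition multiplicity (F : finFieldType) s (E : 'rV[F]_s) (b : F) : nat :=
  #|[set j | E 0 j == b]|.

(* The coefficients split into pairs [b, - b]; the parity clause is what this
   means for self-opposite [b], i.e. for [b = 0] and in characteristic 2. *)
Definition cancelling (F : finFieldType) s (E : 'rV[F]_s) : bool :=
  [forall b, (multiplicity E b == multiplicity E (- b))
             && ((b == - b) ==> ~~ odd (multiplicity E b))].

Lemma prod_multiplicity (C : comNzRingType) (F : finFieldType) s
    (E : 'rV[F]_s) (g : F -> C) :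
  \prod_j g (E 0 j) = \prod_b g b ^+ multiplicity E b.
Proof.
rewrite (partition_big (fun j => E 0 j) xpredT) //=.
apply: eq_bigr => b _; rewrite (eq_bigr (fun=> g b)) => [|j /eqP-> //].
by rewrite prodr_const; congr (_ ^+ _); apply: eq_card => j; rewrite !inE.
Qed.

(** Opposite coefficients contribute powers of [g b * (g b)^*]; at a self-opposite [b] the value
    [g b] is real and its exponent is even. *)
Lemma cancelling_prod_ge0 (C : numClosedFieldType) (F : finFieldType) s
    (E : 'rV[F]_s) (g : F -> C) :
  cancelling E -> (forall b, (g b)^* = g (- b)) -> 0 <= \prod_j g (E 0 j).
Proof.
move=> /forallP cE gC; rewrite prod_multiplicity.
pose G b := g b ^+ multiplicity E b.
have GC b : G (- b) = (G b)^*.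
  by rewrite /G rmorphXn /= gC; have /andP[/eqP-> _] := cE b.
rewrite -/(\prod_b G b) (bigID (fun b => b == - b)) /= mulr_ge0 //.
  apply: prodr_ge0 => b bN; have /andP[_ /implyP/(_ bN) ev] := cE b.
  rewrite /G.
  rewrite -[multiplicity _ _]odd_double_half (negbTE ev) add0n -mul2n exprM.
  by apply: exprn_ge0; rewrite expr2 {2}(eqP bN) -gC mul_conjC_ge0.
(* The enumeration order selects one element from each pair of distinct opposites. *)
pose lt (b : F) := (enum_rank b < enum_rank (- b))%N.
rewrite (bigID lt) /= [X in _ * X](reindex_inj oppr_inj) /=.
rewrite [X in _ * X](eq_bigl (fun b => (b != - b) && lt b)) => [|b]; last first.
  rewrite /lt opprK eq_sym -leqNgt leq_eqVlt.
  case: eqVneq => //= bN; case: eqVneq => //= /val_inj/enum_rank_inj e.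
  by rewrite -e eqxx in bN.
by rewrite [X in _ * X](eq_bigr _ (fun b _ => GC b)) -rmorph_prod mul_conjC_ge0.
Qed.

Definition average (R : realType) (F : finFieldType) n (h : 'rV[F]_n -> R) : R :=
  (\sum_v h v) / #|{: 'rV[F]_n}|%:R.

(* Cancelling equations are Sidorenko: in the Fourier expansion of [Lambda E h]
   every term is nonnegative, and the zero frequency contributes the bound. *)
Lemma cancelling_Lambda_ge_closed (C : numClosedFieldType) (R : realType)
    (iota : {rmorphism R -> C}) (F : finFieldType) n s
    (E : 'rV[F]_s) (h : 'rV[F]_n -> R) :
    (forall x, (iota x)^* = iota x) -> cancelling E ->
  iota (average h ^+ s) <= iota (Lambda E h).
Proof.
move=> iotaC cE.
have [psi psiA psi1] := finField_add_char C F.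
have [psi0 psiD psiC] := psiA.
pose c (u : 'rV[F]_n) : C :=
  (\sum_w iota (h w) * psi (- dotp u w)) / #|{: 'rV[F]_n}|%:R.
have cC u : (c u)^* = c (- u).
  rewrite /c rmorphM fmorphV rmorph_nat rmorph_sum; congr (_ / _).
  apply: eq_bigr => w _; rewrite rmorphM /= iotaC psiC; congr (_ * psi _).
  by rewrite /dotp mulNmx [in RHS]mxE.
have c0 : c 0 = iota (average h).
  rewrite /c /average rmorphM fmorphV rmorph_nat rmorph_sum; congr (_ / _).
  by apply: eq_bigr => w _; rewrite /dotp mul0mx mxE oppr0 psi0 mulr1.
rewrite (Lambda_fourier (c := c) _ psiA psi1); last first.
  exact: (fourier_inversion (fun w => iota (h w)) psiA psi1).
rewrite (bigD1 0) /=; last by rewrite trmx0 sub0mx.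
rewrite (eq_bigr (fun=> c 0)) => [|i _]; last by rewrite row0.
rewrite prodr_const card_ord c0 -rmorphXn lerDl.
apply: sumr_ge0 => r /andP[/submxP[D rD] _].
(* As [E] has a single row, [r^T = D *m E]: all the frequencies in the tuple are multiples of the
   one frequency [D^T]. *)
rewrite (eq_bigr (fun i => c (E 0 i *: D^T))) => [|i _].
  by apply: (cancelling_prod_ge0 (g := fun b => c (b *: D^T))) => // b;
    rewrite cC scaleNr.
congr (c _); apply/rowP=> j; rewrite -(trmxK r) rD !mxE big_ord1.
by rewrite mulrC.
Qed.

Lemma cancelling_Lambda_ge (R : realType) (F : finFieldType) n s
    (E : 'rV[F]_s) (h : 'rV[F]_n -> R) :
  cancelling E -> average h ^+ s <= Lambda E h.
Proof.
move=> cE; rewrite -lecR.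
apply: (cancelling_Lambda_ge_closed (iota := real_complex R)) => // x.
by apply: conj_Creal; apply/complex_realP; exists x.
Qed.

(** Put s = 2t, A = a^2, B = b^2, so that A + B >= 1/2. By Chebyshev, A^(t+1) + B^(t+1) >= (A +
    B)(A^t + B^t)/2 >= (A^t + B^t)/4, which is the induction step on t. *)
Lemma power_mean_even (R : realType) s (a b : R) :
  ~~ odd s -> a + b = 1 -> 2 / 2 ^+ s <= a ^+ s + b ^+ s.
Proof.
move=> /even_halfK <-; rewrite -mul2n !exprM => ab.
elim: (s./2) => [|t IHt]; first by rewrite !expr0 divr1.
have a2b2 : 1 / 2 <= a ^+ 2 + b ^+ 2 by have := sqr_ge0 (a - 1 / 2); rewrite (_ : b = 1 - a); lra.
have Ha : 0 <= a ^+ 2 by exact: sqr_ge0.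
have Hb : 0 <= b ^+ 2 by exact: sqr_ge0.
set A := a ^+ 2 in a2b2 Ha IHt *; set B := b ^+ 2 in a2b2 Hb IHt *.
have Atge : 0 <= A ^+ t by exact: exprn_ge0.
have Btge : 0 <= B ^+ t by exact: exprn_ge0.
(* Chebyshev's sum inequality *)
have cheb : 0 <= (A - B) * (A ^+ t - B ^+ t).
  case: (lerP B A) => AB.
    by rewrite mulr_ge0 // subr_ge0 // lerXn2r.
  have AB' := ltW AB.
  by apply: mulr_le0; rewrite subr_le0 // lerXn2r.
have step : 0 <= (A + B - 1 / 2) * (A ^+ t + B ^+ t).
  by apply: mulr_ge0; [rewrite subr_ge0 | exact: addr_ge0].
have -> : 2 / (2 ^+ 2) ^+ t.+1 = 1 / 4 * (2 / (2 ^+ 2) ^+ t) :> R.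
  by rewrite exprS; field; rewrite !expf_neq0 // pnatr_eq0.
set x := 2 / _ in IHt *; rewrite !exprS; lra.
Qed.

(** The averages of 1/2 + f and 1/2 - f add up to 1, so the power mean inequality applies to the sum
    of their two Sidorenko bounds. *)
Lemma cancelling_common (R : realType) (F : finFieldType) s (E : 'rV[F]_s) :
  ~~ odd s -> cancelling E -> common R E.
Proof.
move=> s_even cE n f _ _.
have pw : (2 : R) ^ (1 - s%:Z) = 2 / 2 ^+ s.
  by rewrite expfzDr ?pnatr_eq0 // expr1z -exprnN.
rewrite pw /Delta.
apply: le_trans (lerD (cancelling_Lambda_ge _ cE) (cancelling_Lambda_ge _ cE)).
apply: power_mean_even => //; rewrite /average -mulrDl -big_split /=.
rewrite (eq_bigr (fun=> 1)) => [|v _]; last lra.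
rewrite sumr_const divff // pnatr_eq0 -lt0n.
by apply/card_gt0P; exists 0.
Qed.

(** * Induced equations and vectors of the row space *)

Lemma submx_ker (F : fieldType) m k (L : 'M[F]_(m, k)) (r : 'rV[F]_k) :
  (forall x : 'cV_k, L *m x = 0 -> r *m x = 0) -> (r <= L)%MS.
Proof.
move=> ker; rewrite submxE; apply/eqP/matrixP=> i j; rewrite ord1.
have /ker : L *m (cokermx L *m delta_mx j 0) = 0 :> 'cV_m.
  by rewrite mulmxA mulmx_coker mul0mx.
by rewrite mulmxA -colE => /matrixP/(_ 0 0); rewrite !mxE.
Qed.

Lemma induces_id (F : finFieldType) m k (L : 'M[F]_(m, k)) (r : 'rV[F]_k) :
  (r <= L)%MS -> induces L r.
Proof.
case/submxP=> D ->; apply/existsP; exists [ffun i => i]; apply/andP; split.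
  by apply/injectiveP=> i j; rewrite !ffunE.
apply/forallP=> x; apply/implyP=> /eqP Lx.
have -> : rowsub [ffun i => i] x = x by apply/matrixP=> i j; rewrite !mxE ffunE.
by rewrite -mulmxA Lx mulmx0.
Qed.

Lemma eq_length_gt0 (F : finFieldType) k (r : 'rV[F]_k) :
  (0 < eq_length r)%N = (r != 0).
Proof.
by apply/card_gt0P/rV0Pn => -[j]; rewrite ?inE => rj; exists j; rewrite ?inE.
Qed.

(** Padding [E] with zeros outside the image of the injection keeps its length. The padded form
    vanishes on all solutions of [L], so it lies in the row space. *)
Lemma induces_row (F : finFieldType) m k l (L : 'M[F]_(m, k)) (E : 'rV[F]_l) :
  induces L E -> exists2 r, (r <= L)%MS & eq_length r = eq_length E.
Proof.
case/existsP=> s /andP[/injectiveP s_inj /forallP ker].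
exists (E *m rowsub s 1%:M).
  apply: submx_ker => x Lx; rewrite -mulmxA mul_rowsub_mx mul1mx.
  by apply/eqP; apply: (implyP (ker x)); rewrite Lx.
have rE i : (E *m rowsub s 1%:M) 0 i = \sum_(j | s j == i) E 0 j.
  rewrite mxE [RHS]big_mkcond; apply: eq_bigr => j _; rewrite !mxE.
  by case: eqP => _; rewrite ?mulr1 ?mulr0.
rewrite /eq_length -(card_imset _ s_inj); apply: eq_card => i; rewrite !inE rE.
apply/idP/imsetP => [|[j]]; last first.
  by rewrite inE => Ej ->; rewrite (big_pred1 j) // => j'; rewrite (inj_eq s_inj).
move=> nz; have [j /eqP sj] : exists j, s j == i.
  apply/existsP; apply: contraNT nz; rewrite negb_exists => /forallP ns.
  by rewrite big1 // => j sj; have := ns j; rewrite sj.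
exists j => //; move: nz; rewrite inE (big_pred1 j) // => j'.
by rewrite -sj (inj_eq s_inj).
Qed.

(** [E] is [r] restricted to its support. The last clause carries phase sums over from [E] to
    [r]. *)
Lemma support_equation (F : finFieldType) m k s (L : 'M[F]_(m, k))
    (r : 'rV[F]_k) : (r <= L)%MS -> eq_length r = s ->
  exists E : 'rV[F]_s, [/\ induces L E, eq_length E = s &
    forall (G : zmodType) (g : F -> G), g 0 = 0 ->
      \sum_j g (E 0 j) = \sum_i g (r 0 i)].
Proof.
move=> rL <-; pose A := [set i | r 0 i != 0].
pose E : 'rV[F]_#|A| := \row_j r 0 (enum_val j).
(* Here [g] may also depend on the position, so that the same identity evaluates [E] on the selected
   coordinates of a solution. *)
have sumE (G : zmodType) (g : F -> 'I_k -> G) :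
    (forall i, g 0 i = 0) ->
    \sum_j g (E 0 j) (enum_val j) = \sum_i g (r 0 i) i.
  move=> g0; rewrite [RHS](bigID (mem A)) /= [X in _ + X]big1 => [|i]; last first.
    by rewrite inE negbK => /eqP->.
  by rewrite addr0 [RHS]big_enum_val; apply: eq_bigr => j _; rewrite mxE.
exists E; split; last by move=> G g g0; apply: (sumE G (fun b _ => g b)).
  apply/existsP; exists [ffun j => enum_val j]; apply/andP; split.
    by apply/injectiveP=> i j; rewrite !ffunE => /enum_val_inj.
  apply/forallP=> x; apply/implyP=> /eqP Lx; apply/eqP/matrixP=> i j.
  have [D rD] := submxP rL.
  have /matrixP/(_ 0 0) : r *m x = 0 by rewrite rD -mulmxA Lx mulmx0.
  rewrite !ord1 !mxE => rx0; rewrite -[RHS]rx0.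
  apply: etrans (sumE F (fun b i => b * x i 0) _) => [|i']; last first.
    by rewrite mul0r.
  by apply: eq_bigr => j' _; rewrite [rowsub _ _ _ _]mxE ffunE.
rewrite {1}/eq_length -[RHS]card_ord; apply: eq_card => j; rewrite !inE mxE.
by have := enum_valP j; rewrite inE.
Qed.

(** * The leading coefficient as d tends to 0 *)

(** With S the leading sum and M the sum of all [|a i|], the expression is at most 2 d^s (S + d M),
    which is negative for small d if S < 0. *)
Lemma even_leading_coef_ge0 (R : realFieldType) (I : finType) (P : pred I)
    (w : I -> nat) (a : I -> R) s (d0 : R) :
    ~~ odd s -> (forall i, P i -> (s <= w i)%N) -> 0 < d0 ->
    (forall d, 0 < d <= d0 ->
       0 <= \sum_(i | P i) (d ^+ w i + (- d) ^+ w i) * a i) ->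
  0 <= \sum_(i | P i && (w i == s)) a i.
Proof.
move=> s_even sw d0_gt0 pos; rewrite leNgt; apply/negP.
set S := \sum_(_ | _) _ => S_lt0; pose M := \sum_(i | P i) `|a i|.
have M_ge0 : 0 <= M by apply: sumr_ge0.
have M1 : 0 < M + 1 by rewrite ltr_wpDl.
(* The bound 1 gives d^w <= d^(s+1) for w > s, and the last bound gives d M < -S; M + 1 keeps the
   denominator positive. *)
pose d := Num.min d0 (Num.min 1 (- S / (2 * (M + 1)))).
have d_gt0 : 0 < d.
  rewrite !lt_min d0_gt0 ltr01 divr_gt0 ?oppr_gt0 //.
  by rewrite mulr_gt0 // ltr0n.
have d_le0 : d <= d0 by rewrite ge_min lexx.
have d_le1 : d <= 1 by rewrite !ge_min lexx orbT.
have ds_ge0 : 0 <= 2 * d ^+ s by rewrite mulr_ge0 ?exprn_ge0 ?ltW ?ltr0n.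
have dM : S + d * M < 0.
  have : d <= - S / (2 * (M + 1)) by rewrite !ge_min lexx !orbT.
  by rewrite ler_pdivlMr ?mulr_gt0 // => ?; nra.
have term i : P i -> (d ^+ w i + (- d) ^+ w i) * a i
    <= 2 * d ^+ s * ((if w i == s then a i else 0) + d * `|a i|).
  move=> /sw; rewrite leq_eqVlt eq_sym; case: eqVneq => [-> _|_ /= sw'].
    rewrite exprNn -signr_odd (negbTE s_even) expr0 mul1r -mulr2n.
    by rewrite -[_ *+ 2]mulr_natl ler_wpM2l // lerDl mulr_ge0 // ltW.
  apply: le_trans (ler_norm _) _; rewrite normrM add0r mulrA ler_wpM2r //.
  apply: le_trans (ler_normD _ _) _.
  rewrite !normrX normrN gtr0_norm // -mulr2n -[_ *+ 2]mulr_natl -mulrA ler_wpM2l //.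
  by rewrite -exprSr ler_wiXn2l // ltW.
have := pos d; rewrite d_gt0 d_le0 => /(_ isT); apply/negP; rewrite -ltNge.
apply: le_lt_trans (ler_sum _ term) _; rewrite -mulr_sumr big_split /=.
rewrite -mulr_sumr -big_mkcondr -/S -/M pmulr_rlt0 //.
by rewrite mulr_gt0 ?exprn_gt0.
Qed.

(** * Odd phases and their averages *)

(** Oddness makes the twisted Fourier coefficients those of a real function. The value at 0 is fixed
    separately because, for even [N], oddness only gives 2 eta(0) = 0. *)
Definition odd_phase (F : finFieldType) N (eta : {ffun F -> 'Z_N}) : bool :=
  (eta 0 == 0) && [forall b, eta (- b) == - eta b].

Lemma sum_multiplicity (G : pzRingType) (F : finFieldType) s (E : 'rV[F]_s) b :
  \sum_j (E 0 j == b)%:R = (multiplicity E b)%:R :> G.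
Proof.
rewrite /multiplicity -sum1_card natr_sum [RHS]big_mkcond; apply: eq_bigr => j _.
by rewrite inE; case: eqP.
Qed.

(* The modulus [2 (s + 1)] exceeds every multiplicity and has an element of
   order 2, which handles the self-opposite coefficients. *)
Lemma noncancelling_odd_phase (F : finFieldType) s (E : 'rV[F]_s) :
    eq_length E = s -> ~~ cancelling E ->
  exists2 u : {ffun F -> 'Z_(s.+1.*2)}, odd_phase u & \sum_j u (E 0 j) != 0.
Proof.
move=> lenE /forallPn[b]; have N1 : (1 < s.+1.*2)%N by rewrite doubleS.
have mult_le c : (multiplicity E c <= s)%N.
  by rewrite /multiplicity -[X in (_ <= X)%N]card_ord max_card.
have mult0 : multiplicity E 0 = 0%N.
  have := cardsC [set j | E 0 j != 0]; rewrite -/(eq_length E) lenE card_ord.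
  move/(canRL (addKn s)); rewrite subnn => <-.
  by apply: eq_card => j; rewrite !inE negbK.
have natr_neq0 x : (x %% s.+1.*2 != 0)%N -> x%:R != 0 :> 'Z_(s.+1.*2).
  by apply: contraNneq => x0; have := val_Zp_nat N1 x; rewrite x0 => <-.
rewrite negb_and negb_imply negbK => /orP[mb | /andP[/eqP bN mb]].
  have b0 : b != 0 by apply: contraNneq mb => ->; rewrite oppr0.
  (* The phase sum is the difference of the multiplicities of [b] and [- b]; both are at most s, so
     they remain distinct modulo 2(s + 1). *)
  pose u : {ffun F -> 'Z_(s.+1.*2)} :=
    [ffun c => (c == b)%:R - (c == - b)%:R].
  exists u => [|{mult0}].
    rewrite /odd_phase !ffunE [0 == - b]eq_sym oppr_eq0 [0 == b]eq_sym (negbTE b0).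
    rewrite subrr eqxx; apply/forallP=> c.
    by rewrite !ffunE opprB eqr_opp -[- c == b]eqr_opp opprK.
  under eq_bigr => j _ do rewrite ffunE.
  rewrite sumrB !sum_multiplicity.
  rewrite subr_eq0; apply: contraNneq mb => /(congr1 val) /=.
  rewrite !val_Zp_nat // !modn_small => [->//||];
    by rewrite -addnn addSn ltnS (leq_trans (mult_le _)) ?leq_addr.
have b0 : b != 0 by apply: contraTneq mb => ->; rewrite mult0.
(* The value s + 1 is its own opposite, as oddness at [b = - b] demands, and an odd multiple of it
   is nonzero. *)
pose u : {ffun F -> 'Z_(s.+1.*2)} := [ffun c => (c == b)%:R * s.+1%:R].
exists u; last first.
  under eq_bigr => j _ do rewrite ffunE.
  rewrite -mulr_suml sum_multiplicity.
  rewrite -natrM natr_neq0 // -(odd_double_half (multiplicity E b)) mb.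
  by rewrite mulnDl mul1n -doubleMl doubleMr addnC modnMDl modn_small // -addnn
    addSn ltnS leq_addl.
rewrite /odd_phase !ffunE [0 == b]eq_sym (negbTE b0) mul0r eqxx; apply/forallP=> c.
rewrite !ffunE -[- c == b]eqr_opp opprK -bN; case: (c == b).
  rewrite mul1r eq_sym -subr_eq0 -opprD oppr_eq0 -natrD addnn.
  by rewrite pchar_Zp.
by rewrite mul0r oppr0.
Qed.

(** Odd phases form a group; translation by [u] multiplies the sum by a character value different
    from 1. *)
Lemma sum_odd_phase_eq0 (C : numClosedFieldType) (F : finFieldType) N k
    (chi : 'Z_N -> C) (r : 'rV[F]_k) (u : {ffun F -> 'Z_N}) :
    add_char chi -> (forall x, (chi x == 1) = (x == 0)) ->
    odd_phase u -> \sum_i u (r 0 i) != 0 ->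
  \sum_(eta : {ffun F -> 'Z_N} | odd_phase eta) chi (\sum_i eta (r 0 i)) = 0.
Proof.
case=> _ chiD _ chi1 /andP[/eqP u0 /forallP uN] ru.
set S := \sum_(_ | _) _.
have : S = chi (\sum_i u (r 0 i)) * S.
  rewrite {1}/S (reindex_inj (addrI u)) /= mulr_sumr.
  apply: eq_big => [eta|eta _].
    rewrite /odd_phase !ffunE u0 add0r; congr (_ && _); apply: eq_forallb => b.
    by rewrite !ffunE (eqP (uN b)) opprD (inj_eq (addrI _)).
  by rewrite -chiD -big_split; congr chi; apply: eq_bigr => i _; rewrite ffunE.
move/eqP; rewrite -subr_eq0 -{1}(mul1r S) -mulrBl mulf_eq0 subr_eq0 eq_sym.
by rewrite chi1 (negbTE ru) => /eqP.
Qed.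

(** * Testing commonness on twisted trigonometric polynomials *)

Lemma prod_eq_length (C : comNzRingType) (F : finFieldType) k (r : 'rV[F]_k)
    (x : C) :
  \prod_i (if r 0 i == 0 then 1 else x) = x ^+ eq_length r.
Proof.
rewrite /eq_length -prodr_const [RHS]big_mkcond; apply: eq_bigr => i _.
by rewrite inE; case: eqP.
Qed.

(* [2^k Delta L f - 2] for the trigonometric polynomial [f] on F with
   coefficients [(d / 2) chi (eta b)], [b != 0].  [iota] and [re] stand for the
   embedding of R in the complex numbers and the real part. *)
Lemma common_twist_ge0 (C : numClosedFieldType) (R : realType)
    (iota : {rmorphism R -> C}) (re : C -> R) (F : finFieldType) m k N
    (L : 'M[F]_(m, k)) (chi : 'Z_N -> C) (eta : {ffun F -> 'Z_N}) (d : R) :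
    {mono iota : x y / x <= y} -> (forall z, iota (re z) = 'Re z) ->
    add_char chi -> odd_phase eta -> common R L -> 0 < d <= #|F|%:R^-1 ->
  0 <= \sum_(r : 'rV[F]_k | (r <= L)%MS && (r != 0))
         (d ^+ eq_length r + (- d) ^+ eq_length r)
         * re (chi (\sum_i eta (r 0 i))).
Proof.
move=> iota_mono iota_re chiA /andP[/eqP eta0 /forallP etaN] comL.
move=> /andP[d_gt0 d_le].
have [chi0 chiD chiC] := chiA.
have [psi psiA psi1] := finField_add_char C F; have [psi0 psiD psiC] := psiA.
have iota_inj : injective iota := fmorph_inj iota.
have half : iota (1 / 2) = 2^-1 by rewrite div1r fmorphV rmorph_nat.
have iota_real x : iota x \is Num.real.
  by rewrite realE -(rmorph0 iota) !iota_mono; apply: le_total.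
pose S (v : 'rV[F]_1) : C :=
  \sum_(u : 'rV[F]_1 | u != 0) chi (eta (u 0 0)) * psi (dotp u v).
have S_real v : S v \is Num.real.
  apply/CrealP; rewrite rmorph_sum /= (reindex_inj oppr_inj) /=.
  apply: eq_big => [u|u _]; first by rewrite oppr_eq0.
  rewrite rmorphM /= chiC psiC !mxE (eqP (etaN _)) opprK.
  by congr (_ * psi _); rewrite /dotp mulNmx mxE opprK.
pose g v := re (S v) / 2.
have iota_g v : iota (g v) = S v / 2.
  by rewrite fmorph_div rmorph_nat iota_re (Creal_ReP _ (S_real v)).
(* [S v] has at most [#|F|] terms of modulus 1; this is why d <= 1/|F| keeps [d * g] within
   [-1/2, 1/2]. *)
have g_bound v : - (#|F|%:R / 2) <= g v <= #|F|%:R / 2.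
  rewrite -2!iota_mono rmorphN iota_g fmorph_div !rmorph_nat -real_ler_norml.
    rewrite normrM normfV [`|2|]ger0_norm ?ler0n //.
    rewrite ler_wpM2r ?invr_ge0 ?ler0n //.
    apply: le_trans (ler_norm_sum _ _ _) _.
    rewrite (eq_bigr (fun=> 1)) => [|u _]; last first.
      by rewrite normrM (add_char_norm _ chiA) (add_char_norm _ psiA) mulr1.
    rewrite sumr_const ler_nat; apply: leq_trans (max_card _) _.
    by rewrite card_mx muln1 expn1.
  by rewrite rpred_div ?S_real ?rpred_nat.
(* Taking x = d and x = -d covers both halves of [Delta]. *)
have Lambda_twist (x : R) (h : 'rV[F]_1 -> R) :
    (forall v, h v = 1 / 2 + x * g v) ->
  Lambda L h = (1 / 2) ^+ k * \sum_(r : 'rV[F]_k | (r <= L)%MS)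
     x ^+ eq_length r * re (chi (\sum_i eta (r 0 i))).
  move=> hE; apply: iota_inj.
  pose c (u : 'rV[F]_1) : C :=
    2^-1 * (if u == 0 then 1 else iota x) * chi (eta (u 0 0)).
  have hc v : iota (h v) = \sum_u c u * psi (dotp u v).
    rewrite hE rmorphD rmorphM iota_g half (bigD1 0) //=; congr (_ + _).
      by rewrite /c eqxx mxE eta0 chi0 /dotp mul0mx mxE psi0 !mulr1.
    rewrite [S v / 2]mulrC mulrA /S mulr_sumr.
    apply: eq_bigr => u u0; rewrite /c (negbTE u0); ring.
  have <- : 'Re (iota (Lambda L h)) = iota (Lambda L h).
    by rewrite (Creal_ReP _ (iota_real _)).
  rewrite (Lambda_fourier _ psiA psi1 hc).
  rewrite (reindex (fun r : 'rV[F]_k => r^T)) /=; last first.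
    by exists trmx => r _; rewrite trmxK.
  rewrite raddf_sum rmorphM rmorphXn half rmorph_sum mulr_sumr.
  apply: eq_big => [r|r _]; first by rewrite trmxK.
  have row_r i : row i r^T 0 0 = r 0 i by rewrite !mxE.
  have row_r0 i : (row i r^T == 0) = (r 0 i == 0).
    apply/eqP/eqP => [e|e]; first by rewrite -row_r e mxE.
    by apply/rowP=> j; rewrite ord1 row_r e mxE.
  rewrite /c !big_split /= prodr_const card_ord.
  rewrite (eq_bigr (fun i => if r 0 i == 0 then 1 else iota x)) => [|i _].
    rewrite prod_eq_length (eq_bigr (fun i => chi (eta (r 0 i)))) => [|i _].
      rewrite -(add_char_sum _ chiA) ReMl; last first.
        by rewrite -half -!rmorphXn -rmorphM iota_real.
      by rewrite rmorphM rmorphXn iota_re mulrA.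
    by rewrite row_r.
  by rewrite row_r0.
have fb v : - (1 / 2) <= d * g v <= 1 / 2.
  have F0 : (0 : R) < #|F|%:R by rewrite ltr0n; apply/card_gt0P; exists 0.
  have dF : d * (#|F|%:R / 2) <= 1 / 2.
    by rewrite mulrA ler_wpM2r ?invr_ge0 ?ler0n // -ler_pdivlMr // mul1r.
  have /andP[g1 g2] := g_bound v; apply/andP; split.
    rewrite lerNl -mulrN; apply: le_trans dF.
    by apply: ler_wpM2l; [exact: ltW | rewrite lerNl].
  by apply: le_trans dF; apply: ler_wpM2l => //; exact: ltW.
have := comL 1%N (fun v => d * g v) isT fb.
rewrite /Delta (Lambda_twist d) // (Lambda_twist (- d)); last first.
  by move=> v; rewrite mulNr.
rewrite -mulrDr -big_split /=.
have -> : (2 : R) ^ (1 - k%:Z) = (1 / 2) ^+ k * 2.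
  by rewrite expfzDr ?pnatr_eq0 // expr1z -exprnN mulrC div1r exprVn.
rewrite ler_pM2l ?exprn_gt0 ?divr_gt0 ?ltr0n //.
(* The zero row contributes exactly 2, the rescaled bound from commonness. *)
rewrite (bigD1 0) /=; last by rewrite sub0mx.
have -> : eq_length (0 : 'rV[F]_k) = 0%N.
  by apply/eqP; rewrite -leqn0 leqNgt eq_length_gt0 eqxx.
rewrite big1 => [|i _]; last by rewrite mxE eta0.
have -> : re (chi 0) = 1.
  by apply: iota_inj; rewrite iota_re chi0 rmorph1 (Creal_ReP _ (rpred1 _)).
rewrite !expr0 !mulr1 lerDl.
by under [X in _ -> 0 <= X]eq_bigr => r _ do rewrite mulrDl.
Qed.

(** * Averaging the leading coefficient over the odd phases *)

Theorem theorem1p3 (R : realType) (F : finFieldType) (m k : nat)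
    (hm : (2 <= m)%N) (hmk : (m < k)%N)
    (L : 'M[F]_(m, k)) (hL : row_free L)
    (hs : ~~ odd (min_length L))
    (hE : forall E : 'rV[F]_(min_length L),
       induces L E -> eq_length E = min_length L -> uncommon R E) :
  uncommon R L.
Proof.
move=> comL; have [[l [E0 [E0nz E0L E0len]]] min_le] := min_lengthP (ltnW hm) hL.
set s := min_length L in hs hE E0len min_le.
have N1 : (1 < s.+1.*2)%N by rewrite doubleS.
have [chi chiA chi1] := Zp_add_char (complex R : numClosedFieldType) N1.
pose P (r : 'rV[F]_k) := (r <= L)%MS && (r != 0).
(* This is the leading coefficient, G(eta) in the overview. *)
pose A (eta : {ffun F -> 'Z_(s.+1.*2)}) := \sum_(r | P r && (eq_length r == s))
  complex.Re (chi (\sum_i eta (r 0 i))).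
have A_ge0 (eta : {ffun F -> 'Z_(s.+1.*2)}) : odd_phase eta -> 0 <= A eta.
  move=> eta_odd; apply: (even_leading_coef_ge0 (d0 := #|F|%:R^-1)) => //.
  - by move=> r /andP[rL r0]; apply: min_le r0 (induces_id rL).
  - by rewrite invr_gt0 ltr0n; apply/card_gt0P; exists 0.
  - move=> d; apply: (common_twist_ge0 (iota := real_complex R)) => //.
      exact: lecR.
    exact: complexRe.
have sumA : \sum_(eta : {ffun F -> 'Z_(s.+1.*2)} | odd_phase eta) A eta = 0.
  rewrite /A exchange_big /= big1 // => r /andP[/andP[rL _] /eqP lenr].
  (* Each row of weight s yields an induced equation of length s; it is uncommon, hence not
     cancelling, so some odd phase detects it. *)
  have [E [LE lenE sumE]] := support_equation rL lenr.
  have [|u u_odd] := noncancelling_odd_phase lenE.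
    by apply/negP=> cE; apply: (hE E LE lenE); apply: cancelling_common.
  have u0 : u 0 = 0 by case/andP: u_odd => /eqP.
  rewrite (sumE _ u u0) => ru.
  by rewrite -raddf_sum (sum_odd_phase_eq0 chiA chi1 u_odd ru) raddf0.
have odd0 : odd_phase (0 : {ffun F -> 'Z_(s.+1.*2)}).
  by rewrite /odd_phase !ffunE eqxx; apply/forallP=> b; rewrite !ffunE oppr0.
have [chi0 _ _] := chiA.
(* Nonnegative terms with sum 0 all vanish. But at phase 0 every summand of [A] is 1, and a shortest
   induced equation supplies at least one. *)
have : A 0 = 0 by apply: (psumr_eq0P A_ge0 sumA).
have [r rL lenr] := induces_row E0L.
apply/eqP; rewrite gt_eqF // /A (bigD1 r) /=; last first.
  by rewrite /P rL -eq_length_gt0 lenr E0len eqxx -E0len eq_length_gt0 E0nz.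
have re1 (r' : 'rV[F]_k) :
    complex.Re (chi (\sum_i (0 : {ffun F -> 'Z_(s.+1.*2)}) (r' 0 i))) = 1.
  by rewrite big1 ?chi0 // => i _; rewrite ffunE.
rewrite re1 ltr_wpDr // sumr_ge0 // => r' _.
by rewrite re1.
Qed.
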